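(* Let $n>r\ge 2$ and $1\le t\le 2^r-r-1$ be integers. Suppose that $\mathcal F\subset 2^{[n]}$ is a non-trivial $r$-wise $t$-agreeing family. Then $|\mathcal F|\le (r+t+1)2^{n-r-t}$.
   Context: $[n]=\{1,\ldots,n\}$ and $2^{[n]}$ is its power set. Sets $F_1,\ldots,F_r\subset[n]$ agree on a coordinate $x\in[n]$ if either $x\in\bigcap_{i\in[r]}F_i$ or $x\notin\bigcup_{i\in[r]}F_i$. A family $\mathcal F\subset 2^{[n]}$ is $r$-wise $t$-agreeing if any $r$ sets $F_1,\ldots,F_r\in\mathcal F$ (not necessarily distinct) agree on at least $t$ coordinates. $\mathcal F$ is non-trivial if $\bigcap_{A\in\mathcal F}A=\emptyset$ and $\bigcup_{A\in\mathcal F}A=[n]$. *)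

(* Defs.v *)
From mathcomp Require Import all_boot.
Set Implicit Arguments. Unset Strict Implicit. Unset Printing Implicit Defensive.

Definition agree_on (n r : nat) (Fs : 'I_r -> {set 'I_n}) (x : 'I_n) : bool :=
  [forall i, x \in Fs i] || [forall i, x \notin Fs i].

Definition rwise_t_agreeing (n r t : nat) (F : {set {set 'I_n}}) : Prop :=
  forall Fs : 'I_r -> {set 'I_n}, (forall i, Fs i \in F) ->
    t <= #|[set x | agree_on Fs x]|.

Definition nontrivial (n : nat) (F : {set {set 'I_n}}) : Prop :=
  \bigcap_(A in F) A = set0 /\ \bigcup_(A in F) A = [set: 'I_n].

(* Main.v *)
Require Import Defs.
From mathcomp Require Import all_boot all_order all_algebra.
From mathcomp Require Import zify lra.
From Stdlib Require Import Classical.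
Set Implicit Arguments. Unset Strict Implicit. Unset Printing Implicit Defensive.
Import Order.TTheory GRing.Theory Num.Theory.

(** Up-compressions preserve the agreeing conditions and turn F into an up-set,
    for which "agreeing" becomes "intersecting"; left shifts preserve the latter.
    Non-triviality is used beforehand, to see that F is q-wise
    (r+t-q)-agreeing for every q <= r.  So, with s = r+t+1 <= 2^r, it suffices to
    bound by s/2^(s-1) the density of a shifted up-set G that is q-wise
    (s-1-q)-intersecting for 2 <= q <= r.

    This goes by induction on r and on the ground set.  If s <= 2^(r-1), forget
    the condition q = r.  Otherwise split G by its first element x.  The sets
    containing x form a family for s-1, of density at most (s-1)/2^(s-2);
    by shiftedness the others are r-wise (s-2)-intersecting.  It is enough that
    the latter have density at most 2^-(s-2), which the induction gives when
    s-2 <= 2^r-r-1, and also when, for some q < r, there are q sets through x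
    whose intersection is as small as allowed: all sets avoiding x then contain
    that intersection.  In the remaining case the family of sets
    through x satisfies the conditions with q < r for s rather than s-1, so the
    bound for r-1 makes it sparse enough, by a random-walk estimate.
    That estimate is too weak for r = 3, where s is 7 or 8; there one
    uses that cross-intersecting shifted families cannot all be dense. *)

(** * Shifted families, their slices at the first element, and cross-intersection *)

Notation setfam n := {set {set 'I_n}}.

(** The ground set consists of the elements from [k] on. Every level keeps the type [{set 'I_n}],
    and the first clause confines the members to the current ground set. *)
Definition shifted n k (G : setfam n) : Prop :=
  [/\ forall (A : {set 'I_n}) (i : 'I_n), A \in G -> i \in A -> k <= i,
      forall (A : {set 'I_n}) (i : 'I_n), A \in G -> k <= i -> i |: A \in G
    & forall (A : {set 'I_n}) (i j : 'I_n), A \in G -> k <= i -> i < j ->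
        i \notin A -> j \in A -> i |: (A :\ j) \in G].

(* The elements below k are already dealt with.  For k >= n there is nothing to
   split, and both slices are G itself: this keeps [dens_rec] and the cross
   lemmas valid at every level. *)
Definition slice n k (b : bool) (G : setfam n) : setfam n :=
  if insub k is Some x then
    [set A : {set 'I_n} | (x \notin A) && ((if b then x |: A else A) \in G)]
  else G.

Definition cross n r t (Gs : 'I_r -> setfam n) : Prop :=
  forall As : 'I_r -> {set 'I_n}, (forall i, As i \in Gs i) ->
    t <= #|\bigcap_(i < r) As i|.

Definition meets n r t (G : setfam n) : Prop := cross t (fun _ : 'I_r => G).

Lemma sliceE n (x : 'I_n) b (G : setfam n) :
  slice x b G = [set A : {set 'I_n} | (x \notin A) && ((if b then x |: A else A) \in G)].
Proof. by rewrite /slice valK. Qed.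

Lemma slice_oob n k b (G : setfam n) : n <= k -> slice k b G = G.
Proof. by move=> nk; rewrite /slice insubF // ltnNge nk. Qed.

Lemma shifted_oob n k (G : setfam n) A : n <= k -> shifted k G -> A \in G -> A = set0.
Proof.
move=> nk [gG _ _] AG; apply/setP => i; rewrite inE; apply/negP => iA.
by have := gG _ _ AG iA; have := ltn_ord i; lia.
Qed.

Lemma shifted_slice n k b (G : setfam n) : shifted k G -> shifted k.+1 (slice k b G).
Proof.
have [nk wG|kn] := leqP n k.
  rewrite slice_oob //; split.
  - by move=> A i AG; rewrite (shifted_oob nk wG AG) inE.
  - by move=> A i; have := ltn_ord i; lia.
  - by move=> A i; have := ltn_ord i; lia.
move=> [gG uG sG]; pose x := Ordinal kn; rewrite (sliceE x).
have nx (i : 'I_n) : k < i -> i != x.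
  by move=> h; rewrite -(inj_eq val_inj) /=; lia.
split.
- move=> A i; rewrite inE => /andP[xA AG] iA.
  have ix : i != x by apply: contraNneq xA => <-.
  have : k <= i by case: b AG => AG; apply: gG AG _ => //; rewrite inE iA orbT.
  by move: ix; rewrite -(inj_eq val_inj) /=; lia.
- move=> A i; rewrite !inE => /andP[xA AG] ki.
  have ix := nx _ ki; rewrite negb_or eq_sym ix xA /=.
  case: b AG => AG; last by apply: uG => //; lia.
  by rewrite setUCA; apply: uG => //; lia.
- move=> A i j; rewrite !inE => /andP[xA AG] ki ij iA jA.
  have ix := nx _ ki; have jx : j != x by apply: nx; lia.
  rewrite negb_or eq_sym ix negb_and xA orbT /=.
  case: b AG => AG; last by apply: sG => //; lia.
  have -> : x |: (i |: A :\ j) = i |: ((x |: A) :\ j).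
    apply/setP => a; rewrite !inE; case: (eqVneq a x) => [->|] //=.
    by rewrite [x == j]eq_sym jx orbT.
  apply: sG => //; try lia.
    by rewrite !inE negb_or ix.
  by rewrite !inE jA orbT.
Qed.

Lemma slice_mono n k b (G H : setfam n) : G \subset H -> slice k b G \subset slice k b H.
Proof.
move=> /subsetP GH; rewrite /slice; case: insubP => [x _ _|_]; last exact/subsetP.
by apply/subsetP => A; rewrite !inE => /andP[-> /GH].
Qed.

Lemma slice_le n k (G : setfam n) : shifted k G -> slice k false G \subset slice k true G.
Proof.
move=> [_ uG _]; rewrite /slice; case: insubP => [x _ xk|_] //.
by apply/subsetP => A; rewrite !inE => /andP[-> AG] /=; apply: uG; rewrite -?xk.
Qed.

(** A left shift replaces the second remaining element by the first. For [r = 3] this puts slices of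
    several subfamilies inside a single one. *)
Lemma slice_swap n k (G : setfam n) : shifted k G ->
  slice k.+1 true (slice k false G) \subset slice k.+1 false (slice k true G).
Proof.
move=> wG; have [nk|kn] := leqP n k.+1.
  by rewrite !(slice_oob _ _ nk); exact: slice_le.
have kn' : k < n by lia.
rewrite (sliceE (Ordinal kn)) (sliceE (Ordinal kn)) !(sliceE (Ordinal kn')).
set y := Ordinal kn; set x := Ordinal kn'.
have xy : x != y by rewrite -(inj_eq val_inj) /=; lia.
apply/subsetP => A; rewrite !inE negb_or xy /= => /and3P[yA xA AG].
rewrite yA xA /=; case: wG => _ _ sG.
have -> : x |: A = x |: ((y |: A) :\ y).
  congr (_ |: _); apply/setP => a; rewrite !inE.
  by case: eqVneq => //= ->; rewrite (negbTE yA).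
apply: sG => //=; rewrite ?inE ?eqxx ?negb_or ?xy ?xA //.
Qed.

(* Shifting turns a common element of the sets into the popular element x of
   all but one of the sets missing x, at the cost of one common element each. *)
Lemma cross_gain n r t (x : 'I_n) (Gs : 'I_r -> setfam n)
    (As : 'I_r -> {set 'I_n}) z :
  (forall i, shifted x (Gs i)) -> cross t Gs -> 0 < t ->
  (forall i, As i \in Gs i) -> #|[set i | x \notin As i]| = z.+1 ->
  t + z <= #|\bigcap_(i < r) As i|.
Proof.
move=> wG cG t0; elim: z As => [|z IH] As AG cz.
  by rewrite addn0; apply: cG.
have tI := cG _ AG.
have /card_gt0P [y yI] : 0 < #|\bigcap_(i < r) As i| by exact: leq_trans tI.
have {}yI i : y \in As i by move/bigcapP: yI => /(_ i isT).
have /card_gt0P [i0] : 0 < #|[set i | x \notin As i]| by rewrite cz.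
rewrite inE => xi0.
have yx : y != x by apply: contraNneq xi0 => <-.
have xy : x < y.
  case: (wG i0) => /(_ _ _ (AG i0) (yI i0)) h _ _.
  by move: yx; rewrite -(inj_eq val_inj) /=; lia.
pose As' i := if i == i0 then x |: (As i0 :\ y) else As i.
have AG' i : As' i \in Gs i.
  rewrite /As'; case: eqP => [->|_] //.
  by case: (wG i0) => _ _; apply.
have E : [set i | x \notin As' i] = [set i | x \notin As i] :\ i0.
  apply/setP => i; rewrite !inE /As'; case: eqP => //= _.
  by rewrite !inE eqxx.
have c' : #|[set i | x \notin As' i]| = z.+1.
  by have := cardsD1 i0 [set i | x \notin As i]; rewrite -E inE xi0 cz; lia.
have := IH _ AG' c'.
suff : \bigcap_(i < r) As' i \subset (\bigcap_(i < r) As i) :\ y.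
  move/subset_leq_card => h h2.
  have := cardsD1 y (\bigcap_(i < r) As i).
  have -> : y \in \bigcap_(i < r) As i by apply/bigcapP.
  by move=> ->; rewrite addnS add1n ltnS; exact: leq_trans h2 h.
(* A set missing [x] remains after the shift, so [x] does not enter the new intersection, which only
   loses [y]. *)
have /card_gt0P [i1] : 0 < #|[set i | x \notin As' i]| by rewrite c'.
rewrite inE => xi1.
apply/subsetP => a /bigcapP aI.
have ax : a != x by apply: contraNneq xi1 => <-; apply: aI.
have := aI i0 isT; rewrite /As' eqxx !inE (negbTE ax) /= => /andP[ay ai0].
rewrite ay /=; apply/bigcapP => i _.
by have := aI i isT; rewrite /As'; case: eqP => [->|].
Qed.

Definition lift_slice n (x : 'I_n) (b : bool) (A : {set 'I_n}) :=
  if b then x |: A else A.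

(** If all slices are taken through the first element, its removal costs one common element. With
    [z + 1] slices off it, [cross_gain] gives [t + z]. The truncated formula covers both cases. *)
Lemma cross_slice n r t k (bs : 'I_r -> bool) (Gs : 'I_r -> setfam n) :
  (forall i, shifted k (Gs i)) -> cross t Gs -> 0 < t ->
  cross (t + #|[set i | ~~ bs i]|).-1 (fun i => slice k (bs i) (Gs i)).
Proof.
move=> wG cG t0 As; have [nk|kn] := leqP n k.
  move=> AG; have {}AG i : As i \in Gs i by have := AG i; rewrite slice_oob.
  case: r bs Gs wG cG As AG => [|r] bs Gs wG cG As AG.
    have := cG _ AG; have -> : [set i | ~~ bs i] = set0.
      by apply/setP => -[].
    by rewrite cards0; lia.
  have := cG _ AG; rewrite (bigD1 ord0) //= (shifted_oob nk (wG _) (AG _)).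
  by rewrite set0I cards0; lia.
pose x := Ordinal kn; move=> AG.
have {}AG i : (x \notin As i) /\ lift_slice x (bs i) (As i) \in Gs i.
  by have := AG i; rewrite (sliceE x) inE => /andP[].
pose Bs i := lift_slice x (bs i) (As i).
have BG i : Bs i \in Gs i by case: (AG i).
have xB i : x \notin Bs i = ~~ bs i.
  rewrite /Bs /lift_slice; case: (bs i); first by rewrite !inE eqxx.
  by case: (AG i) => ->.
have E : [set i | x \notin Bs i] = [set i | ~~ bs i].
  by apply/setP => i; rewrite !inE xB.
case cz : #|[set i | ~~ bs i]| => [|z].
  have : \bigcap_(i < r) Bs i \subset x |: \bigcap_(i < r) As i.
    apply/subsetP => a /bigcapP aB; rewrite !inE.
    case: eqVneq => //= ax; apply/bigcapP => i _.
    have := aB i isT; rewrite /Bs /lift_slice; case: (bs i) => //.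
    by rewrite !inE (negbTE ax).
  move=> /subset_leq_card h2; have := leq_trans (cG _ BG) h2.
  rewrite cardsU1 addn0 -subn1 leq_subLR => /leq_trans; apply.
  by rewrite leq_add2r leq_b1.
have := @cross_gain n r t x Gs Bs z wG cG t0 BG; rewrite E cz.
move=> /(_ erefl) h; rewrite addnS /=; apply: leq_trans h _.
have /card_gt0P [i0] : 0 < #|[set i | ~~ bs i]| by rewrite cz.
rewrite inE => bi0.
apply/subset_leq_card/subsetP => a /bigcapP aB; apply/bigcapP => i _.
have ax : a != x.
  apply/eqP => ax; have := aB i0 isT; rewrite ax; apply/negP.
  by rewrite xB.
have := aB i isT; rewrite /Bs /lift_slice; case: (bs i) => //.
by rewrite !inE (negbTE ax).
Qed.

Lemma cross_leq n r t t' (Gs : 'I_r -> setfam n) :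
  t' <= t -> cross t Gs -> cross t' Gs.
Proof. by move=> h c As AG; apply: leq_trans h (c _ AG). Qed.

Lemma meets_slice1 n r t k (G : setfam n) :
  shifted k G -> meets r t G -> meets r t.-1 (slice k true G).
Proof.
move=> wG c; case: (posnP t) => [-> As _|t0] //.
have := @cross_slice n r t k (fun=> true) (fun=> G) (fun=> wG) c t0.
by apply: cross_leq; lia.
Qed.

Lemma meets_slice0 n r t k (G : setfam n) :
  shifted k G -> 0 < t -> meets r t G -> meets r (t + r).-1 (slice k false G).
Proof.
move=> wG t0 c.
have := @cross_slice n r t k (fun=> false) (fun=> G) (fun=> wG) c t0.
have -> : [set i : 'I_r | ~~ false] = [set: 'I_r] by apply/setP => i; rewrite !inE.
by rewrite cardsT card_ord.
Qed.

(** * Pairs and triples of cross-intersecting families *)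

Definition cross3 n t (X Y Z : setfam n) : Prop :=
  forall A B C, A \in X -> B \in Y -> C \in Z -> t <= #|A :&: B :&: C|.

Definition cross2 n t (X Y : setfam n) : Prop :=
  forall A B, A \in X -> B \in Y -> t <= #|A :&: B|.

Definition pick3 T (X Y Z : T) (i : 'I_3) :=
  match val i with 0 => X | 1 => Y | _ => Z end.

Definition pick2 T (X Y : T) (i : 'I_2) :=
  match val i with 0 => X | _ => Y end.

Lemma cross3P n t (X Y Z : setfam n) :
  cross t (pick3 X Y Z) <-> cross3 t X Y Z.
Proof.
split=> [c A B C AX BY CZ|c As AG].
  have := c (pick3 A B C); rewrite !big_ord_recl big_ord0 setIT setIA.
  by apply; case=> [[|[|[|]]]].
rewrite !big_ord_recl big_ord0 setIT setIA; apply: c.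
- exact: (AG ord0).
- exact: (AG (lift ord0 ord0)).
- exact: (AG (lift ord0 (lift ord0 ord0))).
Qed.

Lemma cross2P n t (X Y : setfam n) :
  cross t (pick2 X Y) <-> cross2 t X Y.
Proof.
split=> [c A B AX BY|c As AG].
  have := c (pick2 A B); rewrite !big_ord_recl big_ord0 setIT.
  by apply; case=> [[|[|]]].
rewrite !big_ord_recl big_ord0 setIT; apply: c.
- exact: (AG ord0).
- exact: (AG (lift ord0 ord0)).
Qed.

Lemma cross3_slice n t k b1 b2 b3 (X Y Z : setfam n) :
  shifted k X -> shifted k Y -> shifted k Z -> 0 < t -> cross3 t X Y Z ->
  cross3 (t + (~~ b1 + ~~ b2 + ~~ b3)).-1
    (slice k b1 X) (slice k b2 Y) (slice k b3 Z).
Proof.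
move=> wX wY wZ t0 /cross3P c; apply/cross3P.
have wG i : shifted k (pick3 X Y Z i) by case: i => [[|[|[|]]]].
have c' := @cross_slice n 3 t k (pick3 b1 b2 b3) _ wG c t0.
have E : #|[set i | ~~ pick3 b1 b2 b3 i]| = ~~ b1 + ~~ b2 + ~~ b3.
  rewrite -sum1_card big_mkcond !big_ord_recl big_ord0 !in_set /pick3 /=.
  by clear; case: b1; case: b2; case: b3.
rewrite E in c'; move=> As AG; apply: c' => i; have := AG i.
by case: i => [[|[|[|]]]].
Qed.

Lemma cross2_slice n t k b1 b2 (X Y : setfam n) :
  shifted k X -> shifted k Y -> 0 < t -> cross2 t X Y ->
  cross2 (t + (~~ b1 + ~~ b2)).-1 (slice k b1 X) (slice k b2 Y).
Proof.
move=> wX wY t0 /cross2P c; apply/cross2P.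
have wG i : shifted k (pick2 X Y i) by case: i => [[|[|]]].
have c' := @cross_slice n 2 t k (pick2 b1 b2) _ wG c t0.
have E : #|[set i | ~~ pick2 b1 b2 i]| = ~~ b1 + ~~ b2.
  rewrite -sum1_card big_mkcond !big_ord_recl big_ord0 !in_set /pick2 /=.
  by clear; case: b1; case: b2.
rewrite E in c'; move=> As AG; apply: c' => i; have := AG i.
by case: i => [[|[|]]].
Qed.

Lemma meets2P n t (G : setfam n) : meets 2 t G -> cross2 t G G.
Proof.
move=> c; apply/cross2P => As AG; apply: c => i; have := AG i.
by rewrite /pick2; case: (val i).
Qed.

Lemma meets3P n t (G : setfam n) : meets 3 t G -> cross3 t G G G.
Proof.
move=> c; apply/cross3P => As AG; apply: c => i; have := AG i.
by rewrite /pick3; case: (val i) => [|[]].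
Qed.

(** * Densities of shifted families *)

Local Open Scope ring_scope.

Definition dens n k (G : setfam n) : rat := #|G|%:R / 2 ^+ (n - k).

Lemma dens_ge0 n k (G : setfam n) : 0 <= dens k G.
Proof. by rewrite divr_ge0 ?ler0n ?exprn_ge0. Qed.

Lemma dens_mono n k (G H : setfam n) : G \subset H -> dens k G <= dens k H.
Proof.
move=> GH; rewrite ler_wpM2r ?invr_ge0 ?exprn_ge0 //.
by rewrite ler_nat subset_leq_card.
Qed.

Lemma dens0 n k : dens k (set0 : setfam n) = 0.
Proof. by rewrite /dens cards0 mul0r. Qed.

Lemma dens_rec n k (G : setfam n) :
  dens k G = (dens k.+1 (slice k true G) + dens k.+1 (slice k false G)) / 2.
Proof.
have [nk|kn] := leqP n k.
  rewrite !slice_oob // /dens.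
  have -> : (n - k.+1 = n - k)%N by lia.
  lra.
rewrite /dens -mulrDl -natrD -mulrA -invfM -exprSr.
have -> : (n - k = (n - k.+1).+1)%N by lia.
congr (_%:R / _); rewrite !(sliceE (Ordinal kn)); set x := Ordinal kn.
rewrite -(cardsID [set A : {set 'I_n} | x \in A] G); congr (_ + _)%N; last first.
  by apply: eq_card => A; rewrite !inE andbC.
rewrite -(@card_in_imset _ _ (fun A : {set 'I_n} => A :\ x)); last first.
  move=> A B; rewrite !inE => /andP[_ xA] /andP[_ xB] E.
  by rewrite -(setD1K xA) E setD1K.
apply: eq_card => A; rewrite [in RHS]inE; apply/imsetP/andP => [[B]|[xA AG]].
  by rewrite !inE => /andP[BG xB] ->; rewrite setD11 setD1K.
by exists (x |: A); rewrite ?inE ?eqxx ?AG // setU1K.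
Qed.

Lemma dens_oob n k (G : setfam n) : (n <= k)%N -> shifted k G -> dens k G <= 1.
Proof.
move=> nk wG; rewrite /dens; have -> : (n - k = 0)%N by lia.
rewrite expr0 divr1 -[1]/(1%:R) ler_nat -(cards1 (set0 : {set 'I_n})).
by apply/subset_leq_card/subsetP => A AG; rewrite inE (shifted_oob nk wG AG).
Qed.

Lemma level_ind n (P : nat -> Prop) :
  (forall k, (n <= k)%N -> P k) ->
  (forall k, (k < n)%N -> (forall k', (k < k')%N -> P k') -> P k) ->
  forall k, P k.
Proof.
move=> P0 PS k; have [m] := ubnP (n - k); elim: m k => // m IH k km.
have [/P0 //|kn] := leqP n k; apply: PS => // k' kk'; apply: IH; lia.
Qed.

Lemma dens_le1 n k (G : setfam n) : shifted k G -> dens k G <= 1.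
Proof.
elim/(@level_ind n): k G => [k nk|k kn IH] G wG; first exact: dens_oob.
rewrite dens_rec; have := IH k.+1 (ltnSn k) _ (shifted_slice true wG).
have := IH k.+1 (ltnSn k) _ (shifted_slice false wG); lra.
Qed.

Lemma dens_oob0 n k r t (G : setfam n) : (n <= k)%N -> shifted k G -> (0 < r)%N ->
  (0 < t)%N -> meets r t G -> dens k G = 0.
Proof.
move=> nk wG r0 t0 c; case: (set_0Vmem G) => [->|[A AG]]; first exact: dens0.
have := c (fun=> A) (fun=> AG).
rewrite (shifted_oob nk wG AG); case: r r0 c => // r _ _.
by rewrite (bigD1 ord0) //= set0I cards0 leqNgt t0.
Qed.

(** Slicing one family through and the other off the first element keeps the pair
    cross-intersecting, as [(1 + 1).-1 = 1]. Averaging the two mixed pairs gives the bound. *)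
Lemma cross2_dens n k (X Y : setfam n) : shifted k X -> shifted k Y -> cross2 1 X Y ->
  dens k X + dens k Y <= 1.
Proof.
elim/(@level_ind n): k X Y => [k nk|k kn IH] X Y wX wY c.
  case: (set_0Vmem X) => [->|[A AX]]; first by rewrite dens0 add0r dens_oob.
  case: (set_0Vmem Y) => [->|[B BY]]; first by rewrite dens0 addr0 dens_oob.
  have := c A B AX BY; by rewrite (shifted_oob nk wX AX) set0I cards0.
rewrite (dens_rec k X) (dens_rec k Y).
have := IH _ (ltnSn k) _ _ (shifted_slice true wX) (shifted_slice false wY)
  (@cross2_slice _ 1 _ true false _ _ wX wY isT c).
have := IH _ (ltnSn k) _ _ (shifted_slice false wX) (shifted_slice true wY)
  (@cross2_slice _ 1 _ false true _ _ wX wY isT c).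
lra.
Qed.

Lemma meets2_dens n k t (G : setfam n) : shifted k G -> (0 < t)%N -> meets 2 t G ->
  dens k G <= 1 / 2.
Proof.
move=> wG t0 c; have := cross2_dens wG wG (meets2P (cross_leq t0 c)); lra.
Qed.

Lemma dens3_le1 n k (X Y Z : setfam n) :
  shifted k X -> shifted k Y -> shifted k Z -> dens k X * dens k Y * dens k Z <= 1.
Proof.
move=> wX wY wZ; have := (dens_ge0 k X, dens_ge0 k Y, dens_ge0 k Z).
move=> [[X0 Y0] Z0]; apply: mulr_ile1 (mulr_ge0 X0 Y0) Z0 _ (dens_le1 wZ).
exact: mulr_ile1 X0 Y0 (dens_le1 wX) (dens_le1 wY).
Qed.

(** Write [q = b ^ 3]. For the target [t + 1], a product of slices with [z] of them off the first
    element is at most [q ^ (t + z)], and the eight products add up to at most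
    [q ^ t * (1 + q) ^ 3]. The hypothesis [1 + q <= 2 * b] makes this at most [8 * q ^ (t + 1)]. *)
Lemma cross3_dens n k t (b : rat) (X Y Z : setfam n) :
  0 <= b -> 1 + b ^+ 3 <= 2 * b ->
  shifted k X -> shifted k Y -> shifted k Z -> cross3 t X Y Z ->
  dens k X * dens k Y * dens k Z <= (b ^+ 3) ^+ t.
Proof.
move=> b0 b1; set q := b ^+ 3; have q0 : 0 <= q by exact: exprn_ge0.
elim/(@level_ind n): k t X Y Z => [k nk|k kn IH] [|t] X Y Z wX wY wZ c.
- by rewrite expr0; exact: dens3_le1.
- have -> : dens k X * dens k Y * dens k Z = 0; last exact: exprn_ge0.
  case: (set_0Vmem X) => [->|[A AX]]; first by rewrite dens0 !mul0r.
  case: (set_0Vmem Y) => [->|[B BY]]; first by rewrite dens0 mulr0 mul0r.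
  case: (set_0Vmem Z) => [->|[C CZ]]; first by rewrite dens0 mulr0.
  have := c A B C AX BY CZ.
  by rewrite (shifted_oob nk wX AX) !set0I cards0.
- by rewrite expr0; exact: dens3_le1.
have H b1 b2 b3 := IH _ (ltnSn k) _ _ _ _ (shifted_slice b1 wX) (shifted_slice b2 wY)
  (shifted_slice b3 wZ) (@cross3_slice _ t.+1 _ b1 b2 b3 _ _ _ wX wY wZ isT c).
rewrite (dens_rec k X) (dens_rec k Y) (dens_rec k Z).
move: (H true true true) (H true true false) (H true false true)
  (H true false false) (H false true true) (H false true false)
  (H false false true) (H false false false).
rewrite ![in X in X -> _]/= ?addn0 ?addn1 ?addn2 ?addn3 !succnK !exprS.
have p0 : 0 <= q ^+ t by exact: exprn_ge0.
have key : (1 + q) ^+ 3 <= 8 * q.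
  have -> : 8 * q = (2 * b) ^+ 3 by rewrite exprMn -/q; congr (_ * _).
  by apply: lerXn2r; rewrite ?nnegrE //; lra.
have {key} := ler_wpM2r p0 key.
move: (q ^+ t) => p; clear; move: (dens _ _) (dens _ _) (dens _ _) (dens _ _)
  (dens _ _) (dens _ _) => x1 y1 z1 z0 y0 x0; lra.
Qed.

(** * Trading the number of sets for the size of their intersection *)

Lemma meets_add n q t (G : setfam n) (As : 'I_q -> {set 'I_n}) B :
  meets q.+1 t G -> (forall i, As i \in G) -> B \in G ->
  (t <= #|B :&: \bigcap_(i < q) As i|)%N.
Proof.
move=> c AG BG.
have := c (fun i => if unlift ord0 i is Some j then As j else B).
rewrite big_ord_recl unlift_none.
under eq_bigr do rewrite liftK.
by apply=> i; case: unliftP.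
Qed.

(** Some element common to the [q] sets is missed by a member [B]; intersecting with [B] loses it
    and still leaves [t] elements. *)
Lemma meets_drop n q t k (G : setfam n) : shifted k G ->
  (forall i : 'I_n, (k <= i)%N -> exists2 B, B \in G & i \notin B) ->
  (0 < q)%N -> (0 < t)%N -> meets q.+1 t G -> meets q t.+1 G.
Proof.
move=> [gG _ _] nG q0 t0 c As AG; set I := \bigcap_(i < q) As i.
have tI B : B \in G -> (t <= #|B :&: I|)%N by exact: meets_add.
have /card_gt0P [x] : (0 < #|As (Ordinal q0) :&: I|)%N.
  by apply: leq_trans t0 (tI _ (AG _)).
rewrite inE => /andP[xA xI].
have [B BG xB] := nG x (gG _ _ (AG _) xA).
apply: leq_ltn_trans (tI _ BG) _; apply: proper_card; apply/properP.
by split; [exact: subsetIr | exists x => //; rewrite inE negb_and xB].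
Qed.

Lemma meets_drops n r t k (G : setfam n) : shifted k G ->
  (forall i : 'I_n, (k <= i)%N -> exists2 B, B \in G & i \notin B) ->
  (0 < t)%N -> meets r t G -> forall d, (d < r)%N -> meets (r - d) (t + d) G.
Proof.
move=> wG nG t0 c; elim=> [|d IH] dr; first by rewrite subn0 addn0.
rewrite addnS; apply: meets_drop wG nG _ _ _; try lia.
have -> : ((r - d.+1).+1 = r - d)%N by lia.
by apply: IH; lia.
Qed.

(* With s = r+t+1: the intersection conditions of a non-trivial r-wise
   t-intersecting family.  The subtraction may truncate. *)
Definition profile n r s (G : setfam n) : Prop :=
  forall q, (2 <= q <= r)%N -> meets q (s - 1 - q) G.

Definition profile_bound n r k : Prop :=
  forall s (G : setfam n), shifted k G -> (4 <= s <= 2 ^ r)%N -> profile r s G ->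
    dens k G <= s%:R / 2 ^+ s.-1.

Lemma profile_slice1 n r s k (G : setfam n) :
  shifted k G -> profile r s G -> profile r s.-1 (slice k true G).
Proof.
move=> wG bG q qr; have := meets_slice1 wG (bG q qr).
by apply: cross_leq; lia.
Qed.

(* Either every set contains the first element, or no element is common to
   all sets; then D is empty and [meets_drops] yields a profile. *)
Lemma meets_dens_le n r k t (D : {set 'I_n}) (G : setfam n) : (2 <= r)%N ->
  (forall k', (k <= k')%N -> profile_bound n r k') ->
  shifted k G -> meets r t G -> (forall A, A \in G -> D \subset A) ->
  (t <= #|D| + (2 ^ r - r - 1))%N -> dens k G <= (2 ^+ t)^-1.
Proof.
move=> r2; elim/(@level_ind n): k t D G => [k nk|k kn IH] [|t] D G bb wG cG DG tD.
- by rewrite expr0 invr1 dens_le1.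
- by rewrite (dens_oob0 nk wG _ _ cG) ?invr_ge0 ?exprn_ge0 //; lia.
- by rewrite expr0 invr1 dens_le1.
pose x := Ordinal kn.
case: (boolP [forall A in G, x \in A]) => [/'forall_implyP xG|].
  rewrite dens_rec; have -> : slice k false G = set0.
    apply/setP => A; rewrite (sliceE x) !inE; apply/negP => /andP[xA AG].
    by rewrite (xG _ AG) in xA.
  rewrite dens0 addr0 exprSr invfM ler_pM2r ?invr_gt0 ?ltr0n //.
  apply: (IH _ (ltnSn k) t (D :\ x)).
  - by move=> k' kk'; apply: bb; lia.
  - exact: shifted_slice.
  - exact: meets_slice1 cG.
  - by move=> A; rewrite (sliceE x) inE subDset => /andP[_ /DG].
  - move: tD; rewrite (cardsD1 x D); move: #|_ :\ _| => d.
    by case: (x \in D) => /=; lia.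
rewrite negb_forall => /existsP [A]; rewrite negb_imply => /andP[AG xA].
have [gG uG sG] := wG.
(* Since [A] misses [x], shifting an element of [D] to [x] would give a member that does not contain
   [D]. *)
have D0 : D = set0.
  apply/setP => y; rewrite inE; apply/negP => yD.
  have yA := subsetP (DG _ AG) _ yD.
  have yx : y != x by apply: contraNneq xA => <-.
  have xy : (x < y)%N.
    by have := gG _ _ AG yA; move: yx; rewrite -(inj_eq val_inj) /=; lia.
  have := subsetP (DG _ (sG A x y AG (leqnn k) xy xA yA)) _ yD.
  by rewrite !inE eqxx (negbTE yx).
have nG (i : 'I_n) : (k <= i)%N -> exists2 B, B \in G & i \notin B.
  move=> ki; case: (boolP (i \in A)) => [iA|iA]; last by exists A.
  have ix : i != x by apply: contraNneq xA => <-.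
  have xi : (x < i)%N by move: ix; rewrite -(inj_eq val_inj) /=; lia.
  exists (x |: A :\ i); first exact: sG.
  by rewrite !inE eqxx (negbTE ix).
rewrite D0 cards0 add0n in tD.
have r_lt : (r < 2 ^ r)%N by exact: ltn_expl.
have s_le : (r + t.+1 + 1 <= 2 ^ r)%N by lia.
have := bb k (leqnn k) (r + t.+1 + 1)%N G wG.
have -> : (4 <= r + t.+1 + 1 <= 2 ^ r)%N by apply/andP; split; lia.
move=> /(_ isT) h.
apply: le_trans (h _) _.
  move=> q q2; have := meets_drops wG nG (ltn0Sn t) cG (d := r - q).
  have -> : (r - (r - q) = q)%N by lia.
  have -> : (t.+1 + (r - q) = r + t.+1 + 1 - 1 - q)%N by lia.
  by apply; lia.
have -> : (r + t.+1 + 1).-1 = (r + t.+1)%N by lia.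
(* With [s = r + t.+1 + 1], the factor [s / 2 ^ r] is at most 1. *)
rewrite exprD invfM mulrA ler_piMl ?invr_ge0 ?exprn_ge0 //.
by rewrite ler_pdivrMr ?exprn_gt0 // mul1r -natrX ler_nat.
Qed.

(** At the critical size [2 ^ r - r - 1], [meets_dens_le] applies; each further common element gains
    a factor [b]. Slicing turns [j] into [j - 1] or [j + r - 1], so the recursion closes because
    [1 + b ^ r <= 1 + b ^ 3 <= 2 * b]. *)
Lemma meets_dens_geom n r k j (b : rat) (G : setfam n) : (3 <= r)%N ->
  0 <= b -> b <= 1 -> 1 + b ^+ 3 <= 2 * b ->
  (forall k', (k <= k')%N -> profile_bound n r k') ->
  shifted k G -> meets r (2 ^ r - r - 1 + j) G ->
  dens k G <= (2 ^+ (2 ^ r - r - 1))^-1 * b ^+ j.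
Proof.
move=> r3 b0 b1 bb3; set T0 := (2 ^ r - r - 1)%N.
have r_lt : (r.+1 < 2 ^ r)%N.
  elim: r r3 {T0} => // r IH; rewrite leq_eqVlt => /orP[/eqP [<-] //|/IH].
  by rewrite expnS; lia.
have T00 : (0 < T0)%N by rewrite /T0; lia.
set u := (2 ^+ T0)^-1; have u0 : 0 <= u by rewrite invr_ge0 exprn_ge0.
elim/(@level_ind n): k j G => [k nk|k kn IH] j G bb wG cG.
  by rewrite (dens_oob0 nk wG _ _ cG) ?mulr_ge0 ?exprn_ge0 //; lia.
case: j cG => [|j] cG.
  rewrite expr0 mulr1; apply: (meets_dens_le (D := set0) (r := r)) => //; try lia.
  - by rewrite addn0 in cG.
  - by move=> A _; rewrite sub0set.
rewrite dens_rec.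
have bb' k' : (k < k')%N -> profile_bound n r k' by move=> h; apply: bb; lia.
have c1 : meets r (T0 + j) (slice k true G).
  by have := meets_slice1 wG cG; rewrite addnS.
have c0 : meets r (T0 + (j + r)) (slice k false G).
  have -> : (T0 + (j + r) = (T0 + j.+1 + r).-1)%N by lia.
  by apply: meets_slice0 cG => //; lia.
have := IH _ (ltnSn k) _ _ bb' (shifted_slice true wG) c1.
have := IH _ (ltnSn k) _ _ bb' (shifted_slice false wG) c0.
have bj0 : 0 <= b ^+ j by exact: exprn_ge0.
have br : b ^+ r <= b ^+ 3 by apply: ler_wiXn2l.
rewrite exprD exprS.
have : u * (b ^+ j * b ^+ r) <= u * (b ^+ j * (2 * b - 1)).
  by rewrite ler_wpM2l // ler_wpM2l //; lra.
move: (dens _ _) (dens _ _) (b ^+ r) (b ^+ j) => d0 d1 br' bj'; lra.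
Qed.

Lemma profile_bound2 n k : profile_bound n 2 k.
Proof.
move=> s G wG; rewrite (_ : 2 ^ 2 = 4)%N // -eqn_leq => /eqP <- bG.
have := meets2_dens wG _ (bG 2 isT); rewrite /= => /(_ isT).
by have -> : (4%:R / 2 ^+ 3 = 1 / 2 :> rat) by [].
Qed.

(* Slicing repeatedly at elements contained in the sets lowers s to 2^(r-1),
   where the bound for r-1 gains a factor 2. *)
Lemma profile_dens_geom n r k s (b : rat) (H : setfam n) : (4 <= r)%N ->
  1 <= 2 * b -> b <= 1 -> 1 + b ^+ 3 <= 2 * b ->
  (forall k', profile_bound n r.-1 k') ->
  (forall k', (k <= k')%N -> profile_bound n r k') ->
  (2 ^ r.-1 <= s <= 2 ^ r)%N -> shifted k H ->
  profile r.-1 s H -> meets r (s - 2 - r) H ->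
  dens k H * 2 ^+ (s - 2) <=
    s%:R - 2 ^+ (r - 2) + (s - 3 - (2 ^ r - r - 1))%:R * ((2 * b) ^+ (r - 2) - 1).
Proof.
move=> r4 b2 b1 bb3 bb1; set T0 := (2 ^ r - r - 1)%N; set c := (2 * b) ^+ (r - 2).
have c1 : 1 <= c by rewrite exprn_ege1.
have E1 : (2 ^ r = 2 * 2 ^ r.-1)%N by rewrite -expnS; congr (2 ^ _)%N; lia.
have E2 : (2 ^ r.-1 = 2 * 2 ^ (r - 2))%N by rewrite -expnS; congr (2 ^ _)%N; lia.
have r_lt : (r + 2 <= 2 ^ r.-1)%N.
  elim: r r4 {T0 c c1 E1 E2 bb1} => // r IH; rewrite leq_eqVlt => /orP[/eqP [<-] //|].
  move=> r5; have := IH r5; have -> : (r.+1.-1 = r.-1.+1)%N by lia.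
  by rewrite expnS; lia.
move=> bb /andP[]; elim: s k H bb => [|s IH] k H bb s1 s2 wH bH cH; first lia.
(* When the parameter reaches [2 ^ r.-1], the bound for [r.-1] yields half of it, which equals the
   parameter minus [2 ^ (r - 2)]. *)
have [s_lt|s_ge] := ltnP s (2 ^ r.-1).
  have se : s.+1 = (2 ^ r.-1)%N by lia.
  have h : dens k H <= s.+1%:R / 2 ^+ s by apply: bb1 bH => //; lia.
  have p0 : 0 < 2 ^+ (s.+1 - 2) :> rat by exact: exprn_gt0.
  have Es : 2 ^+ s = 2 * 2 ^+ (s.+1 - 2) :> rat.
    by rewrite -exprS; congr (_ ^+ _); lia.
  have Er : s.+1%:R = 2 * 2 ^+ (r - 2) :> rat.
    by rewrite se E2 natrM natrX.
  have x0 : 0 <= (s.+1 - 3 - T0)%:R * (c - 1) by rewrite mulr_ge0 ?subr_ge0.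
  have : dens k H * 2 ^+ (s.+1 - 2) <= s.+1%:R / 2.
    rewrite -ler_pdivlMr //; apply: le_trans h _; rewrite Es invfM mulrA //.
  by rewrite Er; lra.
have s4 : (4 <= s)%N by lia.
have bb' k' : (k < k')%N -> profile_bound n r k' by move=> h; apply: bb; lia.
have h1 := IH _ _ bb' s_ge (ltnW s2) (shifted_slice true wH) (profile_slice1 wH bH).
have {}h1 : dens k.+1 (slice k true H) * 2 ^+ (s - 2) <=
    s%:R - 2 ^+ (r - 2) + (s - 3 - T0)%:R * (c - 1).
  by apply: h1; have := meets_slice1 wH cH; apply: cross_leq; lia.
have c0 : meets r (s - 2) (slice k false H).
  have -> : (s - 2 = (s.+1 - 2 - r + r).-1)%N by lia.
  by apply: meets_slice0 cH => //; lia.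
have p0 : 0 < 2 ^+ (s - 2) :> rat by exact: exprn_gt0.
(* The truncated difference is 0 while [s - 2 <= T0] and 1 afterwards. Only then is the bound 1
   replaced by the geometric estimate, with at most [r - 2] extra common elements. *)
have h0 : dens k.+1 (slice k false H) * 2 ^+ (s - 2) <=
    1 + ((s.+1 - 3 - T0)%:R - (s - 3 - T0)%:R) * (c - 1).
  have [sT|sT] := leqP (s - 2) T0.
    have -> : (s.+1 - 3 - T0 = s - 3 - T0)%N by lia.
    rewrite subrr mul0r addr0 -ler_pdivlMr // mul1r.
    apply: (meets_dens_le (D := set0) (r := r)) => //; try lia.
    - exact: shifted_slice.
    - by move=> A _; rewrite sub0set.
  have Es : (s - 2 = T0 + (s - 2 - T0))%N by lia.
  rewrite Es in c0.
  have := meets_dens_geom _ _ b1 bb3 bb' (shifted_slice false wH) c0.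
  have b0 : 0 <= b by lra.
  move=> /(_ ltac:(lia) b0) h.
  have -> : (s.+1 - 3 - T0 = (s - 3 - T0).+1)%N by lia.
  set e := (s - 3 - T0)%N.
  have -> : e.+1%:R - e%:R = 1 :> rat by rewrite -natr1 addrAC subrr add0r.
  rewrite mul1r addrC subrK.
  rewrite -ler_pdivlMr //; apply: le_trans h _.
  rewrite {2}Es exprD invfM mulrCA ler_wpM2l ?invr_ge0 ?exprn_ge0 //.
  rewrite ler_pdivlMr ?exprn_gt0 // -exprMn mulrC.
  by apply: ler_weXn2l => //; lia.
have -> : 2 ^+ (s.+1 - 2) = 2 * 2 ^+ (s - 2) :> rat.
  by rewrite -exprS; congr (_ ^+ _); lia.
rewrite dens_rec -[s.+1%:R]natr1.
move: h0 h1; move: (dens _ _) (dens _ _) => d1 d2.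
move: (s.+1 - 3 - T0)%N (s - 3 - T0)%N => e e'; move: (2 ^+ (s - 2)) => p.
move: (2 ^+ (r - 2)) => q; clear; lra.
Qed.

(** Here [31 / 25] is [2 * b] for [b = 31 / 50]. In the induction step the left side at most
    doubles, because [p] is at least 2. *)
Lemma geom_slack p : (2 <= p)%N ->
  p%:R * ((31 / 25) ^+ p - 1) + (31 / 25) ^+ p.+1 <= 2 ^+ p :> rat.
Proof.
elim: p => // p IH; rewrite leq_eqVlt => /orP[/eqP [<-]|p2].
  by rewrite !exprS expr0; lra.
have {IH} := IH p2.
have c1 : (1 : rat) <= 31 / 25 by lra.
have := ler_weXn2l c1 p2.
rewrite !exprS expr0 -[p.+1%:R]natr1; have : 2%:R <= p%:R :> rat by rewrite ler_nat.
move: ((31 / 25) ^+ p) (2 ^+ p) (p%:R) => c q x x2 c2 h.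
have := mulr_ge0 (_ : 0 <= x - 2) (_ : 0 <= c - 31 / 25 * (31 / 25)).
move=> /(_ ltac:(lra) ltac:(lra)); lra.
Qed.

(** * The case [r = 3], with critical size [2 ^ 3 - 3 - 1 = 4] *)

Lemma meets3_dens n k t j (G : setfam n) :
  (forall k', (k <= k')%N -> profile_bound n 3 k') -> shifted k G ->
  t = (4 + j)%N -> meets 3 t G -> dens k G <= 1 / 16 * (31 / 50) ^+ j.
Proof.
move=> bb wG -> cG.
have b0 : (0 : rat) <= 31 / 50 by lra.
have b1 : (31 / 50 : rat) <= 1 by lra.
have b3 : (1 : rat) + (31 / 50) ^+ 3 <= 2 * (31 / 50) by lra.
have := meets_dens_geom (r := 3) isT b0 b1 b3 bb wG cG.
by have -> : (2 ^+ (2 ^ 3 - 3 - 1))^-1 = 1 / 16 :> rat by rewrite (_ : 2 ^ 3 - 3 - 1 = 4)%N //; lra.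
Qed.

Lemma meets3_dens3 n k (G : setfam n) :
  (forall k', (k <= k')%N -> profile_bound n 3 k') -> shifted k G ->
  meets 3 3 G -> dens k G <= 1 / 8.
Proof.
move=> bb wG cG; have := meets_dens_le (D := set0) (r := 3) isT bb wG cG.
have -> : (2 ^+ 3)^-1 = 1 / 8 :> rat by lra.
by apply; [move=> A _; rewrite sub0set | rewrite cards0].
Qed.

(** Here and in the next two lemmas the slice through all the first elements is kept unevaluated:
    [slice_swap] will place it inside [V]. The other parts are bounded by [meets3_dens]. *)
Lemma dens_slice1 n k (E : setfam n) :
  (forall k', (k <= k')%N -> profile_bound n 3 k') -> shifted k E -> meets 3 4 E ->
  dens k E <= (dens k.+1 (slice k true E) + 1 / 16 * (31 / 50) ^+ 2) / 2.
Proof.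
move=> bb wE cE; rewrite dens_rec.
have bb' k' : (k.+1 <= k')%N -> profile_bound n 3 k' by move=> h; apply: bb; lia.
have := @meets3_dens n k.+1 6 2 _ bb' (shifted_slice false wE) erefl
  (meets_slice0 (t := 4) wE isT cE).
lra.
Qed.

Lemma dens_slice11 n k (E : setfam n) :
  (forall k', (k <= k')%N -> profile_bound n 3 k') -> shifted k E -> meets 3 5 E ->
  dens k E <= ((dens k.+2 (slice k.+1 true (slice k true E)) + 1 / 16 * (31 / 50) ^+ 2) / 2
               + 1 / 16 * (31 / 50) ^+ 3) / 2.
Proof.
move=> bb wE cE; rewrite dens_rec.
have bb' k' : (k.+1 <= k')%N -> profile_bound n 3 k' by move=> h; apply: bb; lia.
have := @meets3_dens n k.+1 7 3 _ bb' (shifted_slice false wE) erefl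
  (meets_slice0 (t := 5) wE isT cE).
have := dens_slice1 bb' (shifted_slice true wE) (meets_slice1 wE cE).
lra.
Qed.

Lemma dens_slice111 n k (E : setfam n) :
  (forall k', (k <= k')%N -> profile_bound n 3 k') -> shifted k E -> meets 3 6 E ->
  dens k E <=
    (((dens k.+3 (slice k.+2 true (slice k.+1 true (slice k true E))) + 1 / 16 * (31 / 50) ^+ 2) / 2
      + 1 / 16 * (31 / 50) ^+ 3) / 2 + 1 / 16 * (31 / 50) ^+ 4) / 2.
Proof.
move=> bb wE cE; rewrite dens_rec.
have bb' k' : (k.+1 <= k')%N -> profile_bound n 3 k' by move=> h; apply: bb; lia.
have := @meets3_dens n k.+1 8 4 _ bb' (shifted_slice false wE) erefl
  (meets_slice0 (t := 6) wE isT cE).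
have := dens_slice11 bb' (shifted_slice true wE) (meets_slice1 wE cE).
lra.
Qed.

(** A substitute for square roots in [rat]: [e] is a lower bound for the root of [v]. *)
Lemma le_of_sq_mul (x v e c : rat) : 0 <= x -> 0 <= c -> 0 <= e ->
  e * e <= v -> x * x * v <= c * c -> x * e <= c.
Proof.
move=> x0 c0 e0 ev xv.
rewrite -(@ler_pXn2r _ 2) ?nnegrE ?mulr_ge0 // !expr2.
apply: le_trans xv; rewrite mulrACA ler_wpM2l ?mulr_ge0 //.
Qed.

Lemma exprX3_4 (b : rat) : (b ^+ 3) ^+ 4 = b ^+ 6 * b ^+ 6.
Proof. by rewrite -exprM -exprD. Qed.

(* If V is dense then so is its slice V111, and the product bound for the
   cross-intersecting triples (Q000, Q000, V111), (Q001, Q001, V111),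
   (Q010, Q010, V111) makes these slices of Q sparse. *)
Lemma dens_tradeoff n k (Q V : setfam n) (e : rat) :
  (forall k', (k <= k')%N -> profile_bound n 3 k') -> shifted k Q -> shifted k V ->
  meets 2 2 Q -> meets 3 3 V -> cross3 1 Q Q V ->
  0 <= e -> e * e <= 8 * dens k V - 81 / 200 ->
  dens k Q * e <= 5 / 16 * e + ((31 / 50) ^+ 6 + 2 * (31 / 50) ^+ 3) / 8.
Proof.
move=> bb wQ wV cQ cV cQV e0 eV.
have bb1 k' : (k.+1 <= k')%N -> profile_bound n 3 k' by move=> h; apply: bb; lia.
have bb2 k' : (k.+2 <= k')%N -> profile_bound n 3 k' by move=> h; apply: bb; lia.
have bb3 k' : (k.+3 <= k')%N -> profile_bound n 3 k' by move=> h; apply: bb; lia.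
have wQ1 := shifted_slice true wQ; have wQ0 := shifted_slice false wQ.
have wQ00 := shifted_slice false wQ0; have wQ01 := shifted_slice true wQ0.
have wQ000 := shifted_slice false wQ00; have wQ001 := shifted_slice true wQ00.
have wQ010 := shifted_slice false wQ01; have wQ011 := shifted_slice true wQ01.
have wV1 := shifted_slice true wV; have wV0 := shifted_slice false wV.
have wV11 := shifted_slice true wV1; have wV10 := shifted_slice false wV1.
have wV111 := shifted_slice true wV11; have wV110 := shifted_slice false wV11.
have Q1_le := meets2_dens (t := 1) wQ1 isT (meets_slice1 wQ cQ).
have cQ0 := meets_slice0 (t := 2) wQ isT cQ.
have cQ01 := meets_slice1 wQ0 cQ0.
have Q011_le := meets2_dens (t := 1) wQ011 isT (meets_slice1 wQ01 cQ01).
have V0_le := @meets3_dens n k.+1 5 1 _ bb1 wV0 erefl (meets_slice0 (t := 3) wV isT cV).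
have cV1 := meets_slice1 wV cV.
have V10_le := @meets3_dens n k.+2 4 0 _ bb2 wV10 erefl (meets_slice0 (t := 2) wV1 isT cV1).
have cV11 := meets_slice1 wV1 cV1.
have V110_le := meets3_dens3 bb3 wV110 (meets_slice0 (t := 1) wV11 isT cV11).
(* Two slices off the first element raise the common size by 1, none lowers it by 1. The three final
   triples thus reach sizes 4, 2 and 2. *)
have c1 := @cross3_slice _ 1 _ false false true _ _ _ wQ wQ wV isT cQV.
have c00 := @cross3_slice _ 2 _ false false true _ _ _ wQ0 wQ0 wV1 isT c1.
have c01 := @cross3_slice _ 2 _ true true true _ _ _ wQ0 wQ0 wV1 isT c1.
have c000 := @cross3_slice _ 3 _ false false true _ _ _ wQ00 wQ00 wV11 isT c00.
have c001 := @cross3_slice _ 3 _ true true true _ _ _ wQ00 wQ00 wV11 isT c00.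
have c010 := @cross3_slice _ 1 _ false false true _ _ _ wQ01 wQ01 wV11 isT c01.
have b0 : (0 : rat) <= 31 / 50 by lra.
have b3 : (1 : rat) + (31 / 50) ^+ 3 <= 2 * (31 / 50) by lra.
have p000 := @cross3_dens _ _ 4 _ _ _ _ b0 b3 wQ000 wQ000 wV111 c000.
have p001 := @cross3_dens _ _ 2 _ _ _ _ b0 b3 wQ001 wQ001 wV111 c001.
have p010 := @cross3_dens _ _ 2 _ _ _ _ b0 b3 wQ010 wQ010 wV111 c010.
(* Eight times the density of [V] is V111 + V110 + 2 V10 + 4 V0, where the last three terms are at
   most [1 / 8 + 1 / 8 + 31 / 200 = 81 / 200]. *)
have V111_ge : e * e <= dens k.+3 (slice k.+2 true (slice k.+1 true (slice k true V))).
  apply: le_trans eV _; rewrite (dens_rec k V) (dens_rec _ (slice k true V)).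
  rewrite (dens_rec _ (slice k.+1 true (slice k true V))); lra.
have q0 := exprn_ge0 3 b0.
have q0' := exprn_ge0 6 b0.
rewrite exprX3_4 in p000; rewrite expr2 in p001; rewrite expr2 in p010.
have Q000_le := le_of_sq_mul (dens_ge0 _ _) q0' e0 V111_ge p000.
have Q001_le := le_of_sq_mul (dens_ge0 _ _) q0 e0 V111_ge p001.
have Q010_le := le_of_sq_mul (dens_ge0 _ _) q0 e0 V111_ge p010.
(* The constant [5 / 16] is [1 / 4] from Q1 plus [1 / 16] from Q011; each of the three sparse slices
   has weight [1 / 8]. *)
rewrite (dens_rec k Q) (dens_rec _ (slice k false Q)).
rewrite (dens_rec _ (slice k.+1 false (slice k false Q))).
rewrite (dens_rec _ (slice k.+1 true (slice k false Q))).
have := ler_wpM2r e0 Q1_le; have := ler_wpM2r e0 Q011_le.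
move: Q000_le Q001_le Q010_le.
move: (dens _ _) (dens _ _) (dens _ _) (dens _ _) (dens _ _) => x1 x2 x3 x4 x5.
clear; lra.
Qed.

Lemma profile7_dens n k (V : setfam n) : profile_bound n 3 k -> shifted k V ->
  meets 2 4 V -> meets 3 3 V -> dens k V <= 7 / 64.
Proof.
move=> bb wV c2 c3; have := bb 7 V wV isT.
have -> : 7%:R / 2 ^+ 7.-1 = 7 / 64 :> rat by rewrite /=; lra.
by apply=> -[|[|[|[|q]]]].
Qed.

(* For r = 3, Q consists of the sets through the first t elements, and V of
   those through the first t-1 that avoid the next one; here t = s-4. *)
Lemma profile_bound7 n k (G : setfam n) :
  (forall k', (k < k')%N -> profile_bound n 3 k') -> shifted k G ->
  meets 3 3 G -> meets 2 4 (slice k true G) -> dens k G <= 7 / 64.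
Proof.
move=> bb wG cG cG1.
have bb1 k' : (k.+1 <= k')%N -> profile_bound n 3 k' by move=> h; apply: bb; lia.
have bb2 k' : (k.+2 <= k')%N -> profile_bound n 3 k' by move=> h; apply: bb; lia.
have bb3 k' : (k.+3 <= k')%N -> profile_bound n 3 k' by move=> h; apply: bb; lia.
have wG1 := shifted_slice true wG; have wG0 := shifted_slice false wG.
have wG11 := shifted_slice true wG1; have wG10 := shifted_slice false wG1.
set Q := slice k.+2 true (slice k.+1 true (slice k true G)).
set V := slice k.+2 false (slice k.+1 true (slice k true G)).
have wQ : shifted k.+3 Q by exact: shifted_slice. have wV : shifted k.+3 V by exact: shifted_slice.
have d1 := meets_slice1 wG cG; have d11 := meets_slice1 wG1 d1.
have e11 := meets_slice1 wG1 cG1.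
have cQ : meets 2 2 Q by exact: (meets_slice1 wG11 e11).
have cV2 : meets 2 4 V by exact: (meets_slice0 (t := 3) wG11 isT e11).
have cV3 : meets 3 3 V by exact: (meets_slice0 (t := 1) wG11 isT d11).
have cQV : cross3 1 Q Q V.
  exact: (@cross3_slice _ 1 _ true true false _ _ _ wG11 wG11 wG11 isT (meets3P d11)).
have Q_le := meets2_dens (t := 2) wQ isT cQ.
have V_le := profile7_dens (bb3 _ (leqnn _)) wV cV2 cV3.
have V_ge0 := dens_ge0 k.+3 V.
have c10 := meets_slice0 (t := 2) wG1 isT d1; have c0 := meets_slice0 (t := 3) wG isT cG.
have z1 := @meets3_dens n k.+2 4 0 _ bb2 wG10 erefl c10.
have z0 := @meets3_dens n k.+1 5 1 _ bb1 wG0 erefl c0.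
have y1 := dens_slice1 bb2 wG10 c10; have y0 := dens_slice11 bb1 wG0 c0.
(* Of the first three elements, [V] misses only the third. The sets missing only the second, or only
   the first, shift into it. *)
have s1 : slice k.+2 true (slice k.+1 false (slice k true G)) \subset V by exact: slice_swap.
have s0 := slice_mono k.+2 true (slice_swap wG).
have m1 := dens_mono k.+3 s1; have m0 := dens_mono k.+3 (subset_trans s0 s1).
have E : dens k G = (((dens k.+3 Q + dens k.+3 V) / 2 +
    dens k.+2 (slice k.+1 false (slice k true G))) / 2 + dens k.+1 (slice k false G)) / 2.
  by rewrite dens_rec (dens_rec _ (slice k true G)) (dens_rec _ (slice k.+1 true _)).
(* The value [311 / 500] lies just below the square root of [8 * (99 / 1000) - 81 / 200]. For
   sparser [V] the bound [1 / 2] on [Q] suffices. *)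
have T := @dens_tradeoff n k.+3 Q V (311 / 500) bb3 wQ wV cQ cV3 cQV.
have {}T : 99 / 1000 <= dens k.+3 V -> dens k.+3 Q <= 43 / 100.
  move=> h; have := T ltac:(clear -h; lra) ltac:(clear -h; lra); clear; lra.
rewrite E; clear E.
have [V_lt|/ltW/T {}T] := lerP (dens k.+3 V) (99 / 1000); first by lra.
lra.
Qed.

(** The scheme of [profile_bound7], one level deeper and with three thresholds. On each range the
    upper end bounds [V], and the lower end bounds [Q] through [dens_tradeoff]. *)
Lemma profile_bound8 n k (G : setfam n) :
  (forall k', (k < k')%N -> profile_bound n 3 k') -> shifted k G ->
  meets 3 4 G -> meets 2 5 (slice k true G) -> dens k G <= 1 / 16.
Proof.
move=> bb wG cG cG1.
have bb1 k' : (k.+1 <= k')%N -> profile_bound n 3 k' by move=> h; apply: bb; lia.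
have bb2 k' : (k.+2 <= k')%N -> profile_bound n 3 k' by move=> h; apply: bb; lia.
have bb3 k' : (k.+3 <= k')%N -> profile_bound n 3 k' by move=> h; apply: bb; lia.
have bb4 k' : (k.+4 <= k')%N -> profile_bound n 3 k' by move=> h; apply: bb; lia.
have wG1 := shifted_slice true wG; have wG0 := shifted_slice false wG.
have wG11 := shifted_slice true wG1; have wG10 := shifted_slice false wG1.
set G111 := slice k.+2 true (slice k.+1 true (slice k true G)).
set G110 := slice k.+2 false (slice k.+1 true (slice k true G)).
have wG111 : shifted k.+3 G111 by exact: shifted_slice.
have wG110 : shifted k.+3 G110 by exact: shifted_slice.
set Q := slice k.+3 true G111; set V := slice k.+3 false G111.
have wQ : shifted k.+4 Q by exact: shifted_slice. have wV : shifted k.+4 V by exact: shifted_slice.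
have d1 := meets_slice1 wG cG; have d11 := meets_slice1 wG1 d1.
have d111 : meets 3 1 G111 by exact: (meets_slice1 wG11 d11).
have e11 := meets_slice1 wG1 cG1.
have e111 : meets 2 3 G111 by exact: (meets_slice1 wG11 e11).
have cQ : meets 2 2 Q by exact: (meets_slice1 wG111 e111).
have cV2 : meets 2 4 V by exact: (meets_slice0 (t := 3) wG111 isT e111).
have cV3 : meets 3 3 V by exact: (meets_slice0 (t := 1) wG111 isT d111).
have cQV : cross3 1 Q Q V.
  exact: (@cross3_slice _ 1 _ true true false _ _ _ wG111 wG111 wG111 isT (meets3P d111)).
have Q_le := meets2_dens (t := 2) wQ isT cQ.
have V_le := profile7_dens (bb4 _ (leqnn _)) wV cV2 cV3.
have V_ge0 := dens_ge0 k.+4 V.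
have c110 : meets 3 4 G110 by exact: (meets_slice0 (t := 2) wG11 isT d11).
have c10 := meets_slice0 (t := 3) wG1 isT d1; have c0 := meets_slice0 (t := 4) wG isT cG.
have z2 := @meets3_dens n k.+3 4 0 _ bb3 wG110 erefl c110.
have z1 := @meets3_dens n k.+2 5 1 _ bb2 wG10 erefl c10.
have z0 := @meets3_dens n k.+1 6 2 _ bb1 wG0 erefl c0.
have y2 := dens_slice1 bb3 wG110 c110.
have y1 := dens_slice11 bb2 wG10 c10; have y0 := dens_slice111 bb1 wG0 c0.
have s2 : slice k.+3 true G110 \subset V by exact: slice_swap.
have s1 := slice_mono k.+3 true (slice_swap wG1).
have s0 := slice_mono k.+3 true (slice_mono k.+2 true (slice_swap wG)).
have s12 := subset_trans s1 s2.
have m2 := dens_mono k.+4 s2; have m1 := dens_mono k.+4 s12.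
have m0 := dens_mono k.+4 (subset_trans s0 s12).
have E : dens k G = ((((dens k.+4 Q + dens k.+4 V) / 2 + dens k.+3 G110) / 2 +
    dens k.+2 (slice k.+1 false (slice k true G))) / 2 + dens k.+1 (slice k false G)) / 2.
  by rewrite dens_rec (dens_rec _ (slice k true G)) (dens_rec _ (slice k.+1 true _))
    (dens_rec _ G111).
have T e := @dens_tradeoff n k.+4 Q V e bb4 wQ wV cQ cV3 cQV.
have T1 : 207 / 2500 <= dens k.+4 V -> dens k.+4 Q <= 1111 / 2500.
  move=> h; have := T (507 / 1000) ltac:(clear -h; lra) ltac:(clear -h; lra); clear; lra.
have T2 : 12 / 125 <= dens k.+4 V -> dens k.+4 Q <= 847 / 2000.
  move=> h; have := T (301 / 500) ltac:(clear -h; lra) ltac:(clear -h; lra); clear; lra.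
have T3 : 41 / 400 <= dens k.+4 V -> dens k.+4 Q <= 833 / 2000.
  move=> h; have := T (161 / 250) ltac:(clear -h; lra) ltac:(clear -h; lra); clear; lra.
rewrite E; clear E T.
have [V1|/ltW/T1 {}T1] := lerP (dens k.+4 V) (207 / 2500); first by lra.
have [V2|/ltW/T2 {}T2] := lerP (dens k.+4 V) (12 / 125); first by lra.
have [V3|/ltW/T3 {}T3] := lerP (dens k.+4 V) (41 / 400); first by lra.
lra.
Qed.

(* b slightly exceeds the root 0.618... of 2x = 1 + x^3. *)
Lemma geom_ratio : exists b : rat,
  [/\ 1 <= 2 * b, b <= 1, 1 + b ^+ 3 <= 2 * b
    & forall p, (2 <= p)%N ->
        p%:R * ((2 * b) ^+ p - 1) + (2 * b) ^+ p.+1 <= 2 ^+ p].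
Proof.
exists (31 / 50); split; try lra.
have -> : 2 * (31 / 50) = 31 / 25 :> rat by lra.
exact: geom_slack.
Qed.

(** * The induction on [r] *)

Lemma profile_bound_step n r : (3 <= r)%N ->
  (forall k, profile_bound n r.-1 k) -> forall k, profile_bound n r k.
Proof.
move=> r3 bb1; elim/(@level_ind n) => [k nk|k kn bb] s G wG s4 bG.
  have := bG 2 ltac:(lia) => c2.
  by rewrite (dens_oob0 nk wG _ _ c2) ?divr_ge0 ?ler0n ?exprn_ge0 //; lia.
have [s_le|s_gt] := leqP s (2 ^ r.-1).
  by apply: bb1 => //; [lia | move=> q qr; apply: bG; lia].
case/andP: s4 => s4 s_le.
have E1 : (2 ^ r = 2 * 2 ^ r.-1)%N by rewrite -expnS; congr (2 ^ _)%N; lia.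
have r_lt : (r.+1 <= 2 ^ r.-1)%N.
  elim: r r3 {bb1 bb bG E1 s_gt s_le} => // r IH.
  rewrite leq_eqVlt => /orP[/eqP [<-] //|r3].
  have := IH r3; have -> : (r.+1.-1 = r.-1.+1)%N by lia.
  by rewrite expnS; lia.
have bb' k' : (k.+1 <= k')%N -> profile_bound n r k' by exact: bb.
have wG1 := shifted_slice true wG; have wG0 := shifted_slice false wG.
have bG1 := profile_slice1 wG bG.
have p0 : 0 < 2 ^+ (s - 2) :> rat by exact: exprn_gt0.
have Es : 2 ^+ s.-1 = 2 * 2 ^+ (s - 2) :> rat.
  by rewrite -exprS; congr (_ ^+ _); lia.
have cG : meets r (s - 1 - r) G by apply: bG; lia.
have c0 : meets r (s - 2) (slice k false G).
  have -> : (s - 2 = (s - 1 - r + r).-1)%N by lia.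
  by apply: meets_slice0 cG => //; lia.
have Sn : s%:R = s.-1%:R + 1 :> rat by rewrite natr1; congr (_%:R); lia.
(* The average of [(s - 1) / 2 ^ (s - 2)] and [1 / 2 ^ (s - 2)] is exactly [s / 2 ^ (s - 1)]. *)
have easy : dens k.+1 (slice k false G) <= (2 ^+ (s - 2))^-1 ->
    dens k G <= s%:R / 2 ^+ s.-1.
  move=> h0; have := bb _ (ltnSn k) _ _ wG1 _ bG1.
  move=> /(_ ltac:(lia)); have -> : (s.-1.-1 = s - 2)%N by lia.
  rewrite ler_pdivlMr // => h1; move: h0; rewrite -[X in _ <= X]mul1r ler_pdivlMr //.
  rewrite (dens_rec k G) Es Sn ler_pdivlMr ?mulr_gt0 //; move: h1.
  move: (dens _ _) (dens _ _) (2 ^+ (s - 2)) => d0 d1 p; clear; lra.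
have [sT|sT] := leqP (s - 2) (2 ^ r - r - 1).
  apply: easy; apply: (meets_dens_le (D := set0) (r := r)) => //; try lia.
  by move=> A _; rewrite sub0set.
case: (classic (profile r.-1 s (slice k true G))) => [bG1'|nb]; last first.
  (* A failing condition yields [q] sets whose intersection [D] has at most [s - 2 - q] elements. A
     member of the slice off the first element must meet [D] in that many, so it contains [D]; the
     member [B0] also bounds the size of [D] from below. *)
  apply: easy; case: (set_0Vmem (slice k false G)) => [->|[B0 B0G]].
    by rewrite dens0 invr_ge0 ltW.
  have [q nq] := not_all_ex_not _ _ nb.
  have [qr {}nq] := imply_to_and _ _ nq.
  have [As {}nq] := not_all_ex_not _ _ nq.
  have [AG {}nq] := imply_to_and _ _ nq.
  move/negP: nq; rewrite -ltnNge => nq.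
  set D := \bigcap_(i < q) As i in nq *.
  have cq : meets q.+1 (s - 1 - q.+1) G by apply: bG; lia.
  have BD B : B \in slice k false G -> (s - 1 - q.+1 <= #|B :&: D|)%N.
    pose x := Ordinal kn; rewrite (sliceE x) inE => /andP[xB BG].
    have AG' i : x |: As i \in G.
      by have := AG i; rewrite (sliceE x) inE => /andP[].
    apply: leq_trans (meets_add cq AG' BG) _.
    apply/subset_leq_card/subsetP => y; rewrite !inE => /andP[yB /bigcapP yA].
    rewrite yB; apply/bigcapP => i _; have := yA i isT.
    by rewrite !inE; case: eqVneq yB => [->|] //; rewrite (negbTE xB).
  apply: (meets_dens_le (D := D) (r := r)) => //; try lia.
    move=> B /BD h; apply/setIidPr/eqP; rewrite eqEcard subsetIr /=.
    apply: leq_trans h; rewrite -ltnS; apply: leq_trans nq _; lia.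
  have := leq_trans (BD _ B0G) (subset_leq_card (subsetIr _ _)).
  by lia.
have [r4|r4] := leqP 4 r; last first.
  have r_3 : r = 3 by lia.
  rewrite {bb1 E1 r_lt}r_3 /= in bb bG bG1' cG sT s_le s_gt *.
  (* The bounds [s - 2 > 4] and [s <= 8] leave only these values. *)
  have : s = 7 \/ s = 8 by lia.
  case=> s_; rewrite s_ in bG1' cG *.
    have -> : 7%:R / 2 ^+ 7.-1 = 7 / 64 :> rat by rewrite /=; lra.
    by apply: profile_bound7 => //; exact: (bG1' 2 isT).
  have -> : 8%:R / 2 ^+ 8.-1 = 1 / 16 :> rat by rewrite /=; lra.
  by apply: profile_bound8 => //; exact: (bG1' 2 isT).
have [b [b2 b1 b3 slack]] := geom_ratio.
have h1 := profile_dens_geom r4 b2 b1 b3 bb1 bb' _ wG1 bG1' _.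
have {}h1 := h1 ltac:(lia)
  ltac:(by have := meets_slice1 wG cG; apply: cross_leq; lia).
have Ej : (s - 2 = 2 ^ r - r - 1 + (s - 2 - (2 ^ r - r - 1)))%N by lia.
rewrite Ej in c0.
have b0 : 0 <= b by lra.
have h0 := meets_dens_geom r3 b0 b1 b3 bb' wG0 c0.
(* As [s <= 2 ^ r], there are at most [r - 1] extra common elements. *)
have {}h0 : dens k.+1 (slice k false G) * 2 ^+ (s - 2) <= (2 * b) ^+ (r - 2).+1.
  rewrite -ler_pdivlMr //; apply: le_trans h0 _.
  rewrite {2}Ej exprD invfM mulrCA ler_wpM2l ?invr_ge0 ?exprn_ge0 //.
  rewrite ler_pdivlMr ?exprn_gt0 // -exprMn mulrC.
  by apply: ler_weXn2l => //; lia.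
(* The saving [2 ^ (r - 2)] in [h1] pays for [h0] and for the at most [r - 2] excess terms of
   [h1]. *)
have {}slack := slack (r - 2)%N ltac:(lia).
have c1 : 0 <= (2 * b) ^+ (r - 2) - 1 by rewrite subr_ge0 exprn_ege1.
have e_le : (s - 3 - (2 ^ r - r - 1))%:R <= (r - 2)%:R :> rat.
  by rewrite ler_nat; lia.
have := ler_wpM2r c1 e_le.
rewrite (dens_rec k G) Es ler_pdivlMr ?mulr_gt0 //.
move: h0 h1 slack; move: (dens _ _) (dens _ _) => d0 d1.
move: ((2 * b) ^+ (r - 2)) ((2 * b) ^+ (r - 2).+1) (2 ^+ (s - 2)) (2 ^+ (r - 2)).
move=> c c' p q; clear; lra.
Qed.

Lemma profile_boundP n r : (2 <= r)%N -> forall k, profile_bound n r k.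
Proof.
elim: r => // r IH; rewrite leq_eqVlt => /orP[/eqP [<-]|r2] k.
  exact: profile_bound2.
by apply: profile_bound_step => //; exact: IH.
Qed.

(* Agreeing families: fewer sets agree on more coordinates *)
Local Close Scope ring_scope.

(** The [q] sets agree on some [x], and non-triviality supplies a member [B] that differs from them
    there, whether they contain [x] or miss it. Adding [B] loses [x] but keeps [t] coordinates. *)
Lemma agreeing_drop n q t (F : setfam n) : nontrivial F -> 0 < q -> 0 < t ->
  rwise_t_agreeing q.+1 t F -> rwise_t_agreeing q t.+1 F.
Proof.
move=> [F0 F1] q0 t0 aF Fs FsF; pose i0 := Ordinal q0.
pose Bs B (i : 'I_q.+1) := if unlift ord0 i is Some j then Fs j else B.
have tB B : B \in F -> t <= #|[set y | agree_on (Bs B) y]|.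
  by move=> BF; apply: aF => i; rewrite /Bs; case: unliftP.
have sB B y : agree_on (Bs B) y -> agree_on Fs y && ((y \in B) == (y \in Fs i0)).
  case/orP => /forallP h; apply/andP; split.
  - apply/orP; left; apply/forallP => i.
    by have := h (lift ord0 i); rewrite /Bs liftK.
  - have := h ord0; have := h (lift ord0 i0).
    by rewrite /Bs liftK unlift_none => -> ->.
  - apply/orP; right; apply/forallP => i.
    by have := h (lift ord0 i); rewrite /Bs liftK.
  - have := h ord0; have := h (lift ord0 i0).
    by rewrite /Bs liftK unlift_none => /negbTE -> /negbTE ->.
have /card_gt0P [x] := leq_trans t0 (tB _ (FsF i0)).
rewrite inE => /sB /andP[xS _].
have [B BF xB] : exists2 B, B \in F & (x \in B) != (x \in Fs i0).
  case: (boolP (x \in Fs i0)) => xF.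
    have : x \notin \bigcap_(A in F) A by rewrite F0 inE.
    move/bigcapP => h; apply: NNPP => h'; apply: h => A AF.
    by apply/negP => xA; apply: h'; exists A => //; move/negP/negbTE: xA => ->.
  have : x \in \bigcup_(A in F) A by rewrite F1 inE.
  by case/bigcupP => A AF xA; exists A; rewrite ?xA.
apply: leq_ltn_trans (tB _ BF) _; apply: proper_card; apply/properP; split.
  by apply/subsetP => y; rewrite !inE => /sB /andP[].
exists x; rewrite !inE //; apply/negP => /sB /andP[_].
by rewrite (negbTE xB).
Qed.

Lemma agreeing_drops n r t (F : setfam n) : nontrivial F -> 0 < t ->
  rwise_t_agreeing r t F ->
  forall q, 0 < q <= r -> rwise_t_agreeing q (r + t - q) F.
Proof.
move=> nF t0 aF q /andP[q0 qr].
have [d] : {d | d = r - q} by exists (r - q).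
elim: d q q0 qr => [|d IH] q q0 qr dq.
  have -> : q = r by lia.
  by rewrite addKn.
have -> : r + t - q = (r + t - q.+1).+1 by lia.
by apply: agreeing_drop => //; [lia | apply: IH; lia].
Qed.

(** * Compressions *)

(** A common form of up-compressions and left shifts: [dom] selects the sets to move, and a set
    whose image is already present stays. *)
Definition compress_set n (dom : pred {set 'I_n}) (phi : {set 'I_n} -> {set 'I_n})
  (G : setfam n) (A : {set 'I_n}) :=
  if dom A && (phi A \notin G) then phi A else A.

Definition compress n (dom : pred {set 'I_n}) (phi : {set 'I_n} -> {set 'I_n})
  (G : setfam n) : setfam n := [set compress_set dom phi G A | A in G].

Lemma compress_set_inj n (dom : pred {set 'I_n}) (phi : {set 'I_n} -> {set 'I_n})
    (G : setfam n) :
  (forall A B, dom A -> dom B -> phi A = phi B -> A = B) ->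
  {in G &, injective (compress_set dom phi G)}.
Proof.
move=> inj A B AG BG; rewrite /compress_set.
case: ifP => [/andP[dA nA]|_]; case: ifP => [/andP[dB nB]|_] //.
- exact: inj.
- by move=> E; rewrite E BG in nA.
- by move=> E; rewrite -E AG in nB.
Qed.

(* Take a family satisfying P of maximal total weight. *)
Lemma compress_closed n (J : finType) (dom : J -> pred {set 'I_n})
    (phi : J -> {set 'I_n} -> {set 'I_n}) (w : {set 'I_n} -> nat)
    (P : setfam n -> Prop) :
  (forall j A B, dom j A -> dom j B -> phi j A = phi j B -> A = B) ->
  (forall j A, dom j A -> w A < w (phi j A)) ->
  (forall j G, P G -> P (compress (dom j) (phi j) G)) ->
  forall G, P G -> exists G' : setfam n, [/\ P G', #|G'| = #|G|
    & forall j A, A \in G' -> dom j A -> phi j A \in G'].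
Proof.
move=> inj wlt stab G; pose W (G : setfam n) := \sum_(A in G) w A.
have W_le H : W H <= W setT.
  rewrite /W big_mkcond [X in _ <= X]big_mkcond leq_sum // => A _.
  by rewrite inE; case: ifP.
have [m] := ubnP (W setT - W G); elim: m G => // m IH G Gm PG.
case: (boolP [forall j, forall (A | A \in G), dom j A ==> (phi j A \in G)]) => [|].
  move/forallP => cG; exists G; split=> // j A AG dA.
  by have /forall_inP /(_ _ AG) /implyP /(_ dA) := cG j.
rewrite negb_forall => /existsP [j]; rewrite negb_forall => /existsP [A].
rewrite !negb_imply => /and3P[AG dA nA].
have inj1 := compress_set_inj (G := G) (inj j).
have W_lt : W G < W (compress (dom j) (phi j) G).
  rewrite /W big_imset //= (bigD1 A) //= [X in _ < X](bigD1 A) //=.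
  rewrite -addSn leq_add //.
    by rewrite /compress_set dA nA; apply: wlt.
  apply: leq_sum => B _; rewrite /compress_set; case: ifP => // /andP[dB _].
  exact: ltnW (wlt _ _ dB).
have [|G' [PG' cG' clG']] := IH (compress (dom j) (phi j) G) _ (stab j _ PG).
  by have := W_le (compress (dom j) (phi j) G); lia.
by exists G'; split=> //; rewrite cG' card_in_imset.
Qed.

(** Only agreement on [x] can be lost. In that case all preimages miss [x], and one of them stayed
    because its image is in [G]. Replacing it by this image destroys the agreement on [x], so the
    [t] coordinates are found elsewhere. *)
Lemma agreeing_compress n q t (x : 'I_n) (G : setfam n) : 2 <= q ->
  rwise_t_agreeing q t G ->
  rwise_t_agreeing q t (compress (fun A => x \notin A) (fun A => x |: A) G).
Proof.
move=> q2 aG Fs FsC.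
have [As AP] : exists As : 'I_q -> {set 'I_n}, forall i, As i \in G /\
    Fs i = compress_set (fun A => x \notin A) (fun A => x |: A) G (As i).
  apply: (@fin_all_exists _ _ (fun i A => A \in G /\
    Fs i = compress_set (fun A => x \notin A) (fun A => x |: A) G A)) => i.
  by have /imsetP [A AG ->] := FsC i; exists A.
have AG i : As i \in G by case: (AP i).
have FE i : Fs i = compress_set (fun A => x \notin A) (fun A => x |: A) G (As i).
  by case: (AP i).
have ne y i : y != x -> (y \in Fs i) = (y \in As i).
  by move=> yx; rewrite FE /compress_set; case: ifP => // _; rewrite !inE (negbTE yx).
have agE (Bs : 'I_q -> {set 'I_n}) y :
    (forall i, (y \in Bs i) = (y \in As i)) -> y != x -> agree_on Bs y = agree_on Fs y.
  move=> E yx; rewrite /agree_on; congr (_ || _); apply: eq_forallb => i;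
  by rewrite ne // E.
case: (boolP (agree_on Fs x)) => xF.
  apply: leq_trans (aG _ AG) _; apply/subset_leq_card/subsetP => y.
  rewrite !inE; case: (eqVneq y x) => [->|yx] //; by rewrite (agE As).
case: (boolP (agree_on As x)) => xA; last first.
  apply: leq_trans (aG _ AG) _; apply/subset_leq_card/subsetP => y.
  rewrite !inE; case: (eqVneq y x) => [->|yx]; first by rewrite (negbTE xA).
  by rewrite (agE As).
have [m xm] : exists m, x \notin Fs m.
  move: xF; rewrite /agree_on negb_or negb_forall => /andP[/existsP [m xm] _].
  by exists m.
have [xAm AmG] : x \notin As m /\ x |: As m \in G.
  move: xm; rewrite FE /compress_set.
  case: ifP; first by rewrite !inE eqxx.
  by move=> + xAm; rewrite xAm /= => /negbFE.
have xAi i : x \notin As i.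
  by case/orP: xA => /forallP h //; have := h m; rewrite (negbTE xAm).
pose Bs i := if i == m then x |: As m else As i.
have BG i : Bs i \in G by rewrite /Bs; case: ifP.
apply: leq_trans (aG _ BG) _; apply/subset_leq_card/subsetP => y.
rewrite !inE; case: (eqVneq y x) => [->|yx]; last first.
  rewrite (agE Bs) // => i; rewrite /Bs; case: eqP => // ->.
  by rewrite !inE (negbTE yx).
have [i im] : exists i, i != m.
  case: (eqVneq m (Ordinal (ltnW q2))) => [->|h].
    by exists (Ordinal q2); rewrite -(inj_eq val_inj).
  by exists (Ordinal (ltnW q2)); rewrite eq_sym.
case/orP => /forallP h.
  by have := h i; rewrite /Bs (negbTE im) (negbTE (xAi i)).
by have := h m; rewrite /Bs eqxx !inE eqxx.
Qed.

Lemma upset_sub n (G : setfam n) :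
  (forall (i : 'I_n) A, A \in G -> i \notin A -> i |: A \in G) ->
  forall A B : {set 'I_n}, A \in G -> A \subset B -> B \in G.
Proof.
move=> uG A B; have [m] := ubnP #|B :\: A|; elim: m A => // m IH A Am AG AB.
case: (set_0Vmem (B :\: A)) => [/eqP|[i iB]].
  by rewrite setD_eq0 => BA; have -> : B = A by apply/eqP; rewrite eqEsubset BA.
have := iB; rewrite inE => /andP[iA iB'].
apply: (IH (i |: A)); last by rewrite subUset sub1set iB'.
  rewrite -ltnS; apply: leq_trans Am; rewrite ltnS; apply: proper_card.
  apply/properP; split.
    by apply/subsetP => y; rewrite !inE negb_or => /andP[/andP[_ ->] ->].
  by exists i => //; rewrite !inE eqxx.
by apply: uG.
Qed.

(** Enlarge one set by all coordinates outside the union. A second set still misses these, so every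
    remaining agreement is a common element. *)
Lemma agreeing_meets n q t (G : setfam n) : 2 <= q ->
  (forall (i : 'I_n) A, A \in G -> i \notin A -> i |: A \in G) ->
  rwise_t_agreeing q t G -> meets q t G.
Proof.
move=> q2 uG aG As AG; pose i0 := Ordinal (ltnW q2); pose i1 := Ordinal q2.
pose Z := [set y | [forall i, y \notin As i]].
pose Bs i := if i == i0 then As i0 :|: Z else As i.
have BG i : Bs i \in G.
  rewrite /Bs; case: ifP => // _; exact: (upset_sub uG (AG i0) (subsetUl _ _)).
apply: leq_trans (aG _ BG) _; apply/subset_leq_card/subsetP => y.
rewrite inE => /orP[] /forallP h.
  have y1 : y \in As i1 by have := h i1; rewrite /Bs.
  apply/bigcapP => i _; have := h i; rewrite /Bs; case: eqP => // ->.
  by rewrite !inE => /orP[//|/forallP /(_ i1)]; rewrite y1.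
have := h i0; rewrite /Bs eqxx !inE negb_or => /andP[y0 /negP []].
apply/forallP => i; have := h i; rewrite /Bs; case: eqP => // -> _.
exact: y0.
Qed.

(** For [i < j] the pair [(i, j)] is a left shift; the diagonal pair [(i, i)] adds [i]. One closure
    argument then gives the last two clauses of [shifted]. *)
Definition shift_dom n (p : 'I_n * 'I_n) (A : {set 'I_n}) :=
  [&& p.1 <= p.2, p.1 \notin A & (p.1 == p.2) || (p.2 \in A)].

Definition shift_set n (p : 'I_n * 'I_n) (A : {set 'I_n}) := p.1 |: (A :\ p.2).

(** If all new sets contain [i], a lost [j] is made up for by [i]. Otherwise some unmoved set misses
    [i], and either nothing is lost or its shift can be used in its place. *)
Lemma meets_compress n q t (p : 'I_n * 'I_n) (G : setfam n) :
  meets q t G -> meets q t (compress (shift_dom p) (shift_set p) G).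
Proof.
case: p => i j; set C := compress_set (shift_dom (i, j)) (shift_set (i, j)) G.
move=> cG Fs FsC.
have [As AP] : exists As : 'I_q -> {set 'I_n}, forall l,
    As l \in G /\ Fs l = C (As l).
  apply: (@fin_all_exists _ _ (fun l A => A \in G /\ Fs l = C A)) => l.
  by have /imsetP [A AG ->] := FsC l; exists A.
have AG l : As l \in G by case: (AP l).
have FE l : Fs l = C (As l) by case: (AP l).
have ne y l : y != i -> y != j -> (y \in Fs l) = (y \in As l).
  move=> yi yj; rewrite FE /C /compress_set /shift_set; case: ifP => // _.
  by rewrite !inE (negbTE yi) yj.
have moved l : Fs l = As l \/ [/\ i \notin As l, i \in Fs l & As l :\ j \subset Fs l].
  rewrite FE /C /compress_set; case: ifP => [/andP[/and3P[_ iA _] _]|_]; last by left.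
  right; split=> //; first by rewrite !inE eqxx.
  exact: subsetUr.
have tA := cG _ AG.
have subI (Bs : 'I_q -> {set 'I_n}) : (forall l, Bs l \in G) ->
    \bigcap_(l < q) Bs l \subset \bigcap_(l < q) Fs l ->
    t <= #|\bigcap_(l < q) Fs l|.
  by move=> BG h; exact: leq_trans (cG _ BG) (subset_leq_card h).
case: (eqVneq i j) => [ij|ij].
  apply: (subI As) => //; apply/subsetP => y /bigcapP yA; apply/bigcapP => l _.
  case: (moved l) => [->|[iA iF sF]]; first exact: yA.
  apply: (subsetP sF); rewrite !inE yA // andbT.
  by apply: contraNneq iA; rewrite ij => <-; apply: yA.
case: (boolP [forall l, i \in Fs l]) => [/forallP iF|].
  case: (boolP (j \in \bigcap_(l < q) As l)) => jA; last first.
    apply: (subI As) => //; apply/subsetP => y yA; apply/bigcapP => l _.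
    case: (eqVneq y i) => [->|yi]; first exact: iF.
    rewrite ne //; last by apply: contraNneq jA => <-.
    by move/bigcapP: yA; apply.
  case: (boolP (i \in \bigcap_(l < q) As l)) => iA.
    apply: (subI As) => //; apply/subsetP => y /bigcapP yA; apply/bigcapP => l _.
    case: (moved l) => [->|[]]; first exact: yA.
    by move/bigcapP: iA => ->.
  have iI : i \in \bigcap_(l < q) Fs l by apply/bigcapP.
  have : (\bigcap_(l < q) As l) :\ j \subset (\bigcap_(l < q) Fs l) :\ i.
    apply/subsetP => y; rewrite !inE => /andP[yj yA].
    have yi : y != i by apply: contraNneq iA => <-.
    rewrite yi; apply/bigcapP => l _; rewrite ne //.
    by move/bigcapP: yA; apply.
  move/subset_leq_card => h; apply: leq_trans tA _.
  by rewrite (cardsD1 j) jA [X in _ <= X](cardsD1 i) iI leq_add2l.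
rewrite negb_forall => /existsP [m iFm].
have Fm : Fs m = As m by case: (moved m) => // -[_]; rewrite (negbTE iFm).
have iAm : i \notin As m by rewrite -Fm.
case: (boolP (j \in As m)) => jAm; last first.
  apply: (subI As) => //; apply/subsetP => y /bigcapP yA; apply/bigcapP => l _.
  rewrite ne ?yA //; first by apply: contraNneq iAm => <-; apply: yA.
  by apply: contraNneq jAm => <-; apply: yA.
case: (boolP [forall l, Fs l == As l]) => [/forallP E|].
  apply: (subI As) => //; apply/subsetP => y /bigcapP yA; apply/bigcapP => l _.
  by rewrite (eqP (E l)) yA.
rewrite negb_forall => /existsP [l0 nl0].
have [d0 l0i] : shift_dom (i, j) (As l0) /\ i \notin As l0.
  move: nl0; rewrite FE /C /compress_set; case: ifP; last by rewrite eqxx.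
  by move=> /andP[d _] _; split=> //; case/and3P: d.
have dm : shift_dom (i, j) (As m).
  by case/and3P: d0 => le_ij _ _; rewrite /shift_dom /= in le_ij *; rewrite le_ij iAm jAm orbT.
have pm : shift_set (i, j) (As m) \in G.
  apply: contraT => nG; have := iFm.
  by rewrite FE /C /compress_set dm nG /= /shift_set !inE eqxx.
(* The intersection of the [Bs] avoids [j] because of [m] and [i] because of [l0]; on other elements
   the old and new sets coincide. *)
pose Bs l := if l == m then shift_set (i, j) (As m) else As l.
have BG l : Bs l \in G by rewrite /Bs; case: ifP.
have l0m : l0 != m by apply: contraNneq nl0 => ->; rewrite Fm.
apply: (subI Bs) => //; apply/subsetP => y /bigcapP yB; apply/bigcapP => l _.
have yi : y != i.
  by apply: contraNneq l0i => <-; have := yB l0 isT; rewrite /Bs (negbTE l0m).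
have := yB m isT; rewrite /Bs eqxx /shift_set !inE (negbTE yi) /= => /andP[yj yAm].
rewrite ne //; have := yB l isT; rewrite /Bs; case: eqP => [->|//] _.
exact: yAm.
Qed.

(** Up-compressions come first, as [agreeing_meets] requires an up-set; afterwards only
    intersections are tracked. *)
Lemma agreeing_shifted n r (t : nat -> nat) (F : setfam n) :
  (forall q, 2 <= q <= r -> rwise_t_agreeing q (t q) F) ->
  exists G : setfam n, [/\ #|G| = #|F|, shifted 0 G
    & forall q, 2 <= q <= r -> meets q (t q) G].
Proof.
move=> aF.
have [||x G aG|G1 [aG1 cG1 uG1]] := @compress_closed n 'I_n
  (fun x A => x \notin A) (fun x A => x |: A) (fun A => #|A|)
  (fun G => forall q, 2 <= q <= r -> rwise_t_agreeing q (t q) G) _ _ _ F aF.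
- by move=> x A B xA xB E; rewrite -(setU1K xA) E setU1K.
- by move=> x A xA; rewrite cardsU1 xA.
- by move=> q qr; apply: agreeing_compress; [lia | exact: aG].
have rG1 q : 2 <= q <= r -> meets q (t q) G1.
  by move=> qr; apply: agreeing_meets; [lia | exact: uG1 | exact: aG1].
(* The weight [n - a] is positive and decreasing in [a], so additions and left shifts both raise the
   total. *)
have [||p G rG|G2 [rG2 cG2 uG2]] := @compress_closed n _
  (@shift_dom n) (@shift_set n) (fun A => \sum_(a in A) (n - a))
  (fun G => forall q, 2 <= q <= r -> meets q (t q) G) _ _ _ G1 rG1.
- move=> [i j] A B /and3P[/= _ iA jA] /and3P[/= _ iB jB].
  rewrite /shift_set /= => E.
  have [ij|ij] := eqVneq i j.
    have DE (C : {set 'I_n}) : i \notin C -> C :\ j = C.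
      by move=> iC; apply/setDidPl; rewrite disjoint_sym disjoints1 -ij.
    by move: E; rewrite !DE // => E; rewrite -(setU1K iA) E setU1K.
  rewrite (negbTE ij) /= in jA jB.
  rewrite -(setD1K jA) -(setD1K jB); congr (_ |: _).
  have nD (C : {set 'I_n}) : i \notin C -> i \notin C :\ j.
    by move=> iC; rewrite !inE negb_and iC orbT.
  by rewrite -(setU1K (nD _ iA)) E setU1K // nD.
- move=> [i j] A /and3P[/= ij iA jA]; rewrite /shift_set /=.
  have iD : i \notin A :\ j by rewrite !inE negb_and iA orbT.
  rewrite (big_setU1 _ iD) /=; have := ltn_ord i; have := ltn_ord j.
  case: (eqVneq i j) jA => [E _|nij /= jA].
    have -> : A :\ j = A.
      by apply/setDidPl; rewrite disjoint_sym disjoints1 -E.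
    by move=> _ i_n; rewrite -[X in X < _]add0n ltn_add2r subn_gt0.
  rewrite [X in _ -> _ -> X < _](big_setD1 _ jA) /= => _ i_n.
  rewrite ltn_add2r; apply: ltn_sub2l => //.
  by rewrite ltn_neqAle ij andbT (inj_eq val_inj).
- by move=> q qr; apply: meets_compress; exact: rG.
exists G2; split=> //; first by rewrite cG2.
have addG (A : {set 'I_n}) (i : 'I_n) : A \in G2 -> 0 <= i -> i |: A \in G2.
  move=> AG _; case: (boolP (i \in A)) => iA; first by rewrite (setUidPr _) // sub1set.
  have := uG2 (i, i) A AG; rewrite /shift_dom /shift_set /= leqnn iA eqxx => /(_ isT).
  by rewrite (setDidPl _) // disjoint_sym disjoints1.
split=> // A i j AG _ ij iA jA; apply: (uG2 (i, j) A AG).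
by rewrite /shift_dom /= ltnW // iA jA orbT.
Qed.

(* |F| <= (r+t+1) 2^(n-r-t), stated multiplied through by 2^(r+t)
   to avoid truncated subtraction when n < r + t. *)
Theorem theorem1 (n r t : nat) (F : {set {set 'I_n}}) :
  2 <= r -> r < n -> 1 <= t -> t <= 2 ^ r - r - 1 ->
  nontrivial F -> rwise_t_agreeing r t F ->
  #|F| * 2 ^ (r + t) <= (r + t + 1) * 2 ^ n.
Proof.
move=> r2 _ t1 t_le nF aF.
(* This is the profile with [s = r + t + 1]; the hypothesis on [t] becomes [s <= 2 ^ r]. *)
have aF' q : 2 <= q <= r -> rwise_t_agreeing q (r + t + 1 - 1 - q) F.
  by move=> qr; rewrite addnK; apply: agreeing_drops => //; lia.
have [G [<- wG rG]] := agreeing_shifted aF'.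
have r_lt : r < 2 ^ r by exact: ltn_expl.
have := @profile_boundP n r r2 0 (r + t + 1) G wG _ rG.
move=> /(_ ltac:(lia)); rewrite /dens subn0 addn1 /=.
rewrite ler_pdivlMr ?exprn_gt0 // mulrAC ler_pdivrMr ?exprn_gt0 //.
by rewrite -!natrX -!natrM ler_nat.
Qed.
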